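(* For each $i\in[3]$ let $2\le k_i\le 3$, let $U_i:=\{u^i_1,\dots,u^i_{k_i}\}\subset\mathbb{S}^1$, and let $\lambda^i_1,\dots,\lambda^i_{k_i}>0$. Let $c\in\mathbb{R}^2$. Suppose that $$0=\sum_{l=1}^{k_1}\lambda^1_l u^1_l=\sum_{l=1}^{k_2}\lambda^2_l u^2_l=\sum_{l=1}^{k_3}\lambda^3_l u^3_l .$$ Then $$\max_{l_1,l_2,l_3}\left\|u^1_{l_1}+u^2_{l_2}+u^3_{l_3}-c\right\|_2\ \ge\ 2,$$ where the maximum is over all $l_1\in[k_1]$, $l_2\in[k_2]$, $l_3\in[k_3]$. Moreover, equality holds if and only if $c=0$ and, after a suitable common rotation, we have that $$U_i=\{\pm(\cos(i\pi/3),\sin(i\pi/3))\},\qquad i\in[3].$$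
   Context: $[m]:=\{1,\dots,m\}$; $\|\cdot\|_2$ is the Euclidean norm on $\mathbb{R}^2$ and $\mathbb{S}^1=\{x\in\mathbb{R}^2:\|x\|_2=1\}$. A common rotation means one rotation of $\mathbb{R}^2$ about the origin applied to all three sets $U_1,U_2,U_3$.
   Formalization: In the equality case the sets U_1, U_2, U_3 are determined up to a common rotation and a relabelling of the three sets; with fixed labels the ''only if'' fails, e.g. when U_1 and U_2 of the stated configuration are exchanged. *)

(* Defs.v *)
From HB Require Import structures.
From mathcomp Require Import all_boot all_order all_algebra all_fingroup.
From mathcomp Require Import all_classical all_reals all_analysis.

Set Implicit Arguments.
Unset Strict Implicit.
Unset Printing Implicit Defensive.

Import Order.TTheory GRing.Theory Num.Theory.

Local Open Scope classical_set_scope.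
Local Open Scope ring_scope.

(* The norm `|x| that the library puts on matrices is the sup norm, hence this
   separate Euclidean norm. *)
Definition norm2 (R : realType) (x : 'cV[R]_2) : R :=
  Num.sqrt (\sum_(j < 2) x j 0 ^+ 2).

Definition vec2 (R : realType) (a b : R) : 'cV[R]_2 :=
  \col_(j < 2) if j == 0 then a else b.

(* Counterclockwise, acting on column vectors by left multiplication. *)
Definition rotation_mx (R : realType) (t : R) : 'M[R]_2 :=
  row_mx (vec2 (cos t) (sin t)) (vec2 (- sin t) (cos t)).

(* The seed 0 does not affect the maximum: norms are nonnegative, and there is
   at least one choice of indices l as soon as every k i is positive. *)
Definition max_sum_dist (R : realType) (k : 'I_3 -> nat)
    (u : forall i : 'I_3, 'I_(k i) -> 'cV[R]_2) (c : 'cV[R]_2) : R :=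
  \big[Num.max/0]_(l : {dffun forall i : 'I_3, 'I_(k i)})
     norm2 (\sum_(i < 3) u i (l i) - c).

Definition hex_pair (R : realType) (m : nat) : set 'cV[R]_2 :=
  let v := vec2 (cos (m%:R * pi / 3)) (sin (m%:R * pi / 3)) in [set v; - v].

(* The function max_sum_dist u c is symmetric in the three point sets, while the
   lines spanned by hex_pair 1, hex_pair 2, hex_pair 3 come in a fixed cyclic
   order that rotations preserve. Hence the sets can only be determined up to a
   common rotation t and a relabelling s of the index set: exchanging U_1 and
   U_2 in the model configuration keeps the maximum equal to 2 but is not the
   effect of any rotation. *)
Definition is_hex_configuration (R : realType) (U : 'I_3 -> set 'cV[R]_2) :=
  exists (t : R) (s : 'S_3), forall i : 'I_3,
    (fun x => rotation_mx t *m x) @` U i = @hex_pair R (s i).+1.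

(* Main.v *)
Require Import Defs.
From HB Require Import structures.
From mathcomp Require Import all_boot all_order all_algebra all_fingroup.
From mathcomp Require Import all_classical all_reals all_analysis.
From mathcomp Require Import ring lra.

Set Implicit Arguments.
Unset Strict Implicit.
Unset Printing Implicit Defensive.

Import Order.TTheory GRing.Theory Num.Theory.

Local Open Scope classical_set_scope.
Local Open Scope ring_scope.

(* The key point is that for every direction d there are indices i <> j and
   points x in U_i, y in U_j at an angle at most pi/3 with <x + y, d> >= 0.
   Take in each U_i the point nearest to d, at an angle in [-pi/2, pi/2]. If no
   two of these are within pi/3, the extreme ones have angles a < c with
   c - a > 2pi/3; the neighbour of the first one, respectively of the second
   one, on the side of the other is then within pi/3 of the other, and one of
   these two pairs satisfies the sign condition.

   Taking d opposite to c gives |x + y - c|^2 >= 3 + |c|^2. As 0 is in the convex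
   hull of the third set, it has a point z with <z, x + y - c> >= 0, whence
   |x + y + z - c|^2 >= 4 + |c|^2.

   In the case of equality c = 0, the angle between x and y is exactly pi/3, and
   all points of the third set are orthogonal to x + y, so that this set is
   {y - x, x - y}. Now y and y - x, as well as x and x - y, are again at an angle
   pi/3, which determines the other two sets in the same way. *)

(** * Inner product of the plane and points of the circle given by an angle *)

Definition dot (R : realType) (x y : 'cV[R]_2) : R :=
  x 0 0 * y 0 0 + x 1 0 * y 1 0.

Definition ev (R : realType) (t : R) : 'cV[R]_2 := vec2 (cos t) (sin t).

Lemma evE0 (R : realType) (t : R) : ev t 0 0 = cos t.
Proof. by rewrite mxE. Qed.

Lemma evE1 (R : realType) (t : R) : ev t 1 0 = sin t.
Proof. by rewrite mxE. Qed.

Lemma vec2P (R : realType) (x y : 'cV[R]_2) :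
  x 0 0 = y 0 0 -> x 1 0 = y 1 0 -> x = y.
Proof.
move=> h0 h1; apply/colP; case=> [[|[|//]]] lt_i2.
  by rewrite (_ : Ordinal _ = 0) //; apply: val_inj.
by rewrite (_ : Ordinal _ = 1) //; apply: val_inj.
Qed.

Lemma dotC (R : realType) (x y : 'cV[R]_2) : dot x y = dot y x.
Proof. by rewrite /dot; ring. Qed.

Lemma dotDr (R : realType) (x y z : 'cV[R]_2) :
  dot x (y + z) = dot x y + dot x z.
Proof. by rewrite /dot !mxE; ring. Qed.

Lemma dotDl (R : realType) (x y z : 'cV[R]_2) :
  dot (x + y) z = dot x z + dot y z.
Proof. by rewrite /dot !mxE; ring. Qed.

Lemma dotNr (R : realType) (x y : 'cV[R]_2) : dot x (- y) = - dot x y.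
Proof. by rewrite /dot !mxE; ring. Qed.

Lemma dotNl (R : realType) (x y : 'cV[R]_2) : dot (- x) y = - dot x y.
Proof. by rewrite /dot !mxE; ring. Qed.

Lemma dotZr (R : realType) (a : R) (x y : 'cV[R]_2) :
  dot x (a *: y) = a * dot x y.
Proof. by rewrite /dot !mxE; ring. Qed.

Definition dotE := (dotDl, dotDr, dotNl, dotNr).

Lemma dot_ge0 (R : realType) (x : 'cV[R]_2) : 0 <= dot x x.
Proof. by rewrite /dot -!expr2 addr_ge0 ?sqr_ge0. Qed.

Lemma dot_eq0 (R : realType) (x : 'cV[R]_2) : dot x x = 0 -> x = 0.
Proof.
rewrite /dot -!expr2 => /eqP.
rewrite paddr_eq0 ?sqr_ge0 // !sqrf_eq0 => /andP[/eqP h0 /eqP h1].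
by apply: vec2P; rewrite ?h0 ?h1 mxE.
Qed.

Lemma norm2E (R : realType) (x : 'cV[R]_2) : norm2 x = Num.sqrt (dot x x).
Proof.
rewrite /norm2 big_ord_recl big_ord1 /dot !expr2.
by rewrite (_ : lift ord0 ord0 = 1) //; apply: val_inj.
Qed.

Lemma norm2_eq1 (R : realType) (x : 'cV[R]_2) : norm2 x = 1 -> dot x x = 1.
Proof. by rewrite norm2E => h; rewrite -[LHS]sqr_sqrtr ?dot_ge0 // h expr1n. Qed.

Lemma norm2_le2 (R : realType) (x : 'cV[R]_2) : (norm2 x <= 2) = (dot x x <= 4).
Proof.
by rewrite norm2E -ler_sqr ?nnegrE ?sqrtr_ge0 // sqr_sqrtr ?dot_ge0 // -natrX.
Qed.

Lemma norm2_ge2 (R : realType) (x : 'cV[R]_2) : (2 <= norm2 x) = (4 <= dot x x).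
Proof.
by rewrite norm2E -ler_sqr ?nnegrE ?sqrtr_ge0 // sqr_sqrtr ?dot_ge0 // -natrX.
Qed.

Lemma dot_ev (R : realType) (s t : R) : dot (ev s) (ev t) = cos (s - t).
Proof. by rewrite /dot !evE0 !evE1 cosB. Qed.

Lemma evDpi (R : realType) (t : R) : ev (t + pi) = - ev t.
Proof. by apply: vec2P; rewrite !mxE /= (cosDpi, sinDpi). Qed.

Lemma ev2pi (R : realType) (t : R) : ev (t - pi) = - ev t.
Proof. by rewrite -[t in RHS](subrK pi) evDpi opprK. Qed.

(** * Angles measured from a direction, and values of the cosine *)

(** The coordinates [c] and [s] of [x] in the orthonormal frame [ev d], [ev (d + pi / 2)] satisfy
    c^2 + s^2 = 1, so the angle is [acos c] up to the sign of [s]. *)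
Lemma polar (R : realType) (x : 'cV[R]_2) (d : R) : dot x x = 1 ->
  exists2 t, - pi <= t <= pi & x = ev (d + t).
Proof.
move=> x1; pose c := dot x (ev d); pose s := x 1 0 * cos d - x 0 0 * sin d.
have cs : c ^+ 2 + s ^+ 2 = 1.
  rewrite -x1 /c /s /dot evE0 evE1 -[RHS]mulr1 -[X in _ = _ * X](cos2Dsin2 d); ring.
have c1 : -1 <= c <= 1 by apply/andP; split; nra.
have [t t_pi [ct st]] : exists2 t, - pi <= t <= pi & cos t = c /\ sin t = s.
  have [ge0 lepi] := (acos_ge0 c1, acos_lepi c1).
  have sin_t : sin (acos c) = `|s|.
    by rewrite sin_acos // -[1]cs addrAC subrr add0r sqrtr_sqr.
  have [s0|s0] := leP 0 s.
    exists (acos c); first by apply/andP; split; lra.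
    by rewrite acosK ?in_itv // sin_t ger0_norm.
  exists (- acos c); first by apply/andP; split; lra.
  by rewrite cosN sinN acosK ?in_itv // sin_t ltr0_norm // opprK.
exists t => //; apply: vec2P.
  rewrite evE0 cosD ct st /c /s /dot evE0 evE1.
  transitivity (x 0 0 * (cos d ^+ 2 + sin d ^+ 2)); last by ring.
  by rewrite cos2Dsin2 mulr1.
rewrite evE1 sinD ct st /c /s /dot evE0 evE1.
transitivity (x 1 0 * (cos d ^+ 2 + sin d ^+ 2)); last by ring.
  by rewrite cos2Dsin2 mulr1.
Qed.

(** Measuring angles in either orientation [e] lets mirror-image cases share one proof. *)
Lemma polar_sign (R : realType) (x : 'cV[R]_2) (d e : R) : dot x x = 1 ->
  e = 1 \/ e = -1 -> exists2 t, - pi <= t <= pi & x = ev (d + e * t).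
Proof.
move=> x1 he; have [t /andP[t1 t2] ->] := polar d x1.
exists (e * t); case: he => ->; rewrite ?mulN1r ?mul1r ?opprK //;
  by apply/andP; split; lra.
Qed.

Lemma cos_sign (R : realType) (e t : R) : e = 1 \/ e = -1 -> cos (e * t) = cos t.
Proof. by case=> ->; rewrite ?mulN1r ?mul1r ?cosN. Qed.

Lemma dot_ev_sign (R : realType) (d e s t : R) : e = 1 \/ e = -1 ->
  dot (ev (d + e * s)) (ev (d + e * t)) = cos (s - t).
Proof.
by move=> he; rewrite dot_ev -[RHS](cos_sign _ he) mulrBr; congr cos; ring.
Qed.

Lemma ler_cos (R : realType) (x y : R) :
  0 <= x -> x <= y -> y <= pi -> cos y <= cos x.
Proof.
move=> x0 xy ypi; rewrite leNgt ltr_cos -?leNgt // in_itv /=;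
  by apply/andP; split; lra.
Qed.

(** The triple angle formula and cos pi = -1 give 4c^3 - 3c + 1 = (c + 1)(2c - 1)^2 = 0, where c >
    0. *)
Lemma cos_pi3 (R : realType) : cos (pi / 3 : R) = 1 / 2.
Proof.
have pi0 := pi_gt0 R; set c := cos _.
have c0 : 0 < c by apply: cos_gt0_pihalf; apply/andP; split; lra.
have : cos (pi / 3 + pi / 3 + pi / 3 : R) = -1 by rewrite -cospi; congr cos; lra.
rewrite 2!cosD sinD -/c => h.
have cs : c ^+ 2 + sin (pi / 3) ^+ 2 = 1 := cos2Dsin2 _.
have : (c + 1) * (2 * c - 1) ^+ 2 = 0.
  have -> : (c + 1) * (2 * c - 1) ^+ 2 =
      (c * c - sin (pi / 3) * sin (pi / 3)) * c
      - (sin (pi / 3) * c + c * sin (pi / 3)) * sin (pi / 3) + 1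
      + 3 * c * (c ^+ 2 + sin (pi / 3) ^+ 2 - 1) by ring.
  by rewrite h cs; ring.
move=> /eqP; rewrite mulf_eq0 sqrf_eq0 => /orP[] /eqP; lra.
Qed.

Lemma cos_ge_half (R : realType) (x : R) : - (pi / 3) <= x <= pi / 3 ->
  1 / 2 <= cos x.
Proof.
move=> /andP[x1 x2]; have pi0 := pi_gt0 R.
by rewrite -cos_pi3 -(cos_norm x); apply: ler_cos;
  [exact: normr_ge0|rewrite ler_norml x1|lra].
Qed.

(** * Balanced point sets *)

(* Equivalent to 0 being a combination of all the [U l] with positive weights. *)
Definition balanced (R : realType) n (U : 'I_n -> 'cV[R]_2) :=
  forall e, (forall l, dot (U l) e <= 0) -> forall l, dot (U l) e = 0.

(** Pairing the vanishing combination with [e] gives a sum of nonpositive terms equal to 0, so every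
    term vanishes. *)
Lemma balanced_sum (R : realType) n (U : 'I_n -> 'cV[R]_2) (a : 'I_n -> R) :
  (forall l, 0 < a l) -> \sum_(l < n) a l *: U l = 0 -> balanced U.
Proof.
move=> a0 sum0 e neg l.
have dot_sum : \sum_l a l * dot (U l) e = 0.
  transitivity (dot (\sum_l a l *: U l) e); last by rewrite sum0 /dot !mxE; ring.
  rewrite /dot !summxE !big_distrl -big_split; apply: eq_bigr => i _ /=.
  by rewrite !mxE; ring.
have h : \sum_l - (a l * dot (U l) e) = 0 by rewrite sumrN dot_sum oppr0.
have /(_ l isT)/eqP : forall i, true -> - (a i * dot (U i) e) = 0.
  by apply: psumr_eq0P h => i _; rewrite oppr_ge0 mulr_ge0_le0 // ltW.
by rewrite oppr_eq0 mulf_eq0 gt_eqF //= => /eqP.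
Qed.

Lemma balanced_ge0 (R : realType) n (U : 'I_n -> 'cV[R]_2) e :
  balanced U -> (0 < n)%N -> exists l, 0 <= dot (U l) e.
Proof.
move=> balU n0; apply: contrapT => no.
have neg l : dot (U l) e < 0 by rewrite ltNge; apply/negP => h; apply: no; exists l.
by have := balU e (fun l => ltW (neg l)) (Ordinal n0); have := neg (Ordinal n0); lra.
Qed.

(* The sign [e] is an orientation of the circle: one turns from [U l0] in the
   sense [e]. *)
Lemma next_point (R : realType) n (U : 'I_n -> 'cV[R]_2) l0 (a e : R) :
  balanced U -> (forall l, dot (U l) (U l) = 1) -> e = 1 \/ e = -1 ->
  U l0 = ev a -> exists l, exists2 t, 0 < t <= pi & U l = ev (a + e * t).
Proof.
move=> balU unitU he Ul0; have pi0 := pi_gt0 R.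
have dot_perp t : dot (ev (a + e * t)) (ev (a + e * (pi / 2))) = sin t.
  by rewrite dot_ev_sign // cosBpihalf.
have [[l pos]|npos] :=
    pselect (exists l, 0 < dot (U l) (ev (a + e * (pi / 2)))).
  have [t /andP[t1 t2] Ul] := polar_sign a (unitU l) he.
  exists l, t => //; rewrite t2 andbT ltNge; apply/negP => t0.
  have : 0 <= sin (- t) by apply: sin_ge0_pi; apply/andP; split; lra.
  by move: pos; rewrite Ul dot_perp sinN; lra.
(* With no point strictly on the side [e], balance puts all points on the line through [ev a]; one
   with nonpositive cosine is then the antipode of [U l0]. *)
have perp : forall l, dot (U l) (ev (a + e * (pi / 2))) = 0.
  by apply: balU => l; rewrite leNgt; apply/negP => pos; apply: npos; exists l.
have [l] := balanced_ge0 (- ev a) balU (leq_ltn_trans (leq0n _) (ltn_ord l0)).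
have [t /andP[t1 t2] Ul] := polar_sign a (unitU l) he.
have evE : ev a = ev (a + e * 0) by rewrite mulr0 addr0.
have := perp l; rewrite Ul dot_perp dotNr [in dot _ (ev a)]evE dot_ev_sign //.
rewrite subr0 => sint cost; exists l.
have [t0|t0] := ltP 0 t; first by exists t => //; rewrite t0.
have [t00|t_neq0] := eqVneq t 0; first by move: cost; rewrite t00 cos0; lra.
have t_pi : t = - pi.
  apply/le_anti; rewrite t1 andbT leNgt; apply/negP => t_gt.
  have : 0 < sin (- t).
    by apply: sin_gt0_pi; rewrite oppr_gt0 lt_neqAle t_neq0 t0 /=; lra.
  by rewrite sinN sint oppr0 ltxx.
exists pi; first by rewrite pi0 /=.
by rewrite Ul t_pi; case: he => ->;
  rewrite ?mulN1r ?mul1r ?opprK evDpi ev2pi.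
Qed.

(* No point of [U] lies at an angle in (a, -a), being nearer to [ev d] than
   [U l0]; so the point following [U l0] has its angle in [-a, a + pi]. *)
Lemma next_point_close (R : realType) n (U : 'I_n -> 'cV[R]_2) l0 (d e a c : R) :
  balanced U -> (forall l, dot (U l) (U l) = 1) -> e = 1 \/ e = -1 ->
  U l0 = ev (d + e * a) -> (forall l, dot (U l) (ev d) <= cos a) ->
  - (pi / 2) <= a -> c <= pi / 2 -> 2 * (pi / 3) < c - a -> cos a <= cos c ->
  exists l, 1 / 2 <= dot (U l) (ev (d + e * c)) /\
            0 <= dot (U l + ev (d + e * c)) (ev d).
Proof.
move=> balU unitU he Ul0 nearest a_ge c_le ca cos_le; have pi0 := pi_gt0 R.
have [l [t /andP[t0 t_pi] Ul]] := next_point balU unitU he Ul0.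
exists l; have {}Ul : U l = ev (d + e * (a + t)).
  by rewrite Ul; congr ev; ring.
have evE : ev d = ev (d + e * 0) by rewrite mulr0 addr0.
have at_ge : - a <= a + t.
  rewrite leNgt; apply/negP => at_lt; have := nearest l.
  rewrite Ul evE dot_ev_sign // subr0 leNgt => /negP; apply.
  have lt_norm : `|a + t| < - a by rewrite ltr_norml; apply/andP; split; lra.
  have := normr_ge0 (a + t); rewrite -(cosN a) -(cos_norm (a + t)).
  by move=> ?; rewrite ltr_cos // in_itv /=; apply/andP; split; lra.
rewrite dotDl Ul evE !dot_ev_sign // !subr0; split.
  (* Here a + pi < c + pi/3, and -a > pi/6 >= c - pi/3 because c <= pi/2. *)
  by apply: cos_ge_half; apply/andP; split; lra.
(* On [0, pi] the cosine decreases, so the worst case is the antipode of [U l0], whose component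
   -cos a is compensated by cos c. *)
have : cos (a + pi) <= cos (a + t) by apply: ler_cos; lra.
by rewrite cosDpi; lra.
Qed.

(** * Two close points from different sets *)

(** If all three gaps exceed [b], the two consecutive gaps add up to more than 2b. Of the eight sign
    patterns, six are orderings and the two cyclic ones are contradictory. *)
Lemma close_or_far (R : realType) (x : 'I_3 -> R) (b : R) : 0 <= b ->
  (exists i j, i != j /\ - b <= x i - x j <= b) \/
  (exists i j, i != j /\ 2 * b < x j - x i).
Proof.
move=> b0; have [h|h] := pselect (exists i j, i != j /\ - b <= x i - x j <= b);
  [by left|right].
have far i j : i != j -> x i - x j < - b \/ b < x i - x j.
  move=> ij; apply: contrapT => no; apply: h; exists i, j; split=> //.
  by apply/andP; split; rewrite leNgt; apply/negP => ?; apply: no; [left|right].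
pose o2 : 'I_3 := lift ord0 (lift ord0 ord0); pose o1 : 'I_3 := lift ord0 ord0.
have [h01 h12 h02] : [/\ ord0 != o1, o1 != o2 & ord0 != o2] by [].
have [p|p] := far _ _ h01; have [q|q] := far _ _ h12;
  have [r|r] := far _ _ h02; try by exfalso; lra.
- by exists ord0, o2; split => //; lra.
- by exists ord0, o1; split => //; lra.
- by exists o2, o1; split => //; lra.
- by exists o1, o2; split => //; lra.
- by exists o1, ord0; split => //; lra.
- by exists o2, ord0; split => //; lra.
Qed.

Lemma close_pair (R : realType) (k : 'I_3 -> nat)
    (u : forall i : 'I_3, 'I_(k i) -> 'cV[R]_2) (d : R) :
  (forall i, (0 < k i)%N) -> (forall i, balanced (u i)) ->
  (forall i l, dot (u i l) (u i l) = 1) ->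
  exists i j l m, [/\ i != j, 1 / 2 <= dot (u i l) (u j m) &
                      0 <= dot (u i l + u j m) (ev d)].
Proof.
move=> k0 balu unitu; have pi0 := pi_gt0 R.
have evE e : ev d = ev (d + e * 0) :> 'cV[R]_2 by rewrite mulr0 addr0.
pose nearest i x := [/\ - (pi / 2) <= x, x <= pi / 2 &
  exists l, u i l = ev (d + x) /\ forall m, dot (u i m) (ev d) <= cos x].
have [x xP] : {x : 'I_3 -> R & forall i, nearest i (x i)}.
  apply: choice => i.
  (* The point nearest to [ev d] maximizes the inner product; balance makes this maximum
     nonnegative, so its angle lies in [-pi/2, pi/2]. *)
  pose l := [arg max_(l > Ordinal (k0 i)) dot (u i l) (ev d)]%O.
  have l_max m : dot (u i m) (ev d) <= dot (u i l) (ev d).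
    by rewrite /l; case: arg_maxP => // l' _; exact.
  have l0 : 0 <= dot (u i l) (ev d).
    have [m m0] := balanced_ge0 (ev d) (balu i) (k0 i).
    exact: le_trans m0 (l_max m).
  have [t /andP[t1 t2] ul] := polar d (unitu i l).
  have cost : dot (u i l) (ev d) = cos t by rewrite ul dot_ev addrAC subrr add0r.
  have : `|t| <= pi / 2.
    rewrite leNgt; apply/negP => t_gt; move: l0; rewrite cost leNgt => /negP; apply.
    rewrite -(cos_norm t) -cos_pihalf ltr_cos // in_itv /=; apply/andP; split;
      rewrite ?normr_ge0 // ?ler_norml ?t1 ?t2 //; lra.
  rewrite ler_norml => /andP[t3 t4].
  by exists t; split=> //; exists l; split=> // m; rewrite -cost.
have b0 : 0 <= pi / 3 :> R by lra.
have [[i [j [ij xij]]]|[i [j [ij xij]]]] := close_or_far x b0.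
  have [i1 i2 [l [ul _]]] := xP i; have [j1 j2 [m [um _]]] := xP j.
  exists i, j, l, m; split => //; rewrite ul um.
    by rewrite dot_ev (_ : _ - _ = x i - x j) ?cos_ge_half //; ring.
  rewrite dotDl !dot_ev ![d + _ - d]addrAC subrr !add0r.
  by rewrite addr_ge0 // cos_ge0_pihalf //; apply/andP; split.
have [i1 i2 [l [ul near_i]]] := xP i; have [j1 j2 [m [um near_j]]] := xP j.
(* The extreme point with the smaller component along [ev d] is replaced by its neighbour. In the
   second case the orientation is reversed, so that [- x j] and [- x i] act as the angles [a] and
   [c]. *)
have [le_ij|lt_ji] := leP (cos (x i)) (cos (x j)).
  have ul' : u i l = ev (d + 1 * x i) by rewrite mul1r.
  have [l' ] := next_point_close (balu i) (unitu i) (or_introl erefl) ul' near_i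
    i1 j2 xij le_ij.
  by rewrite [1 * x j]mul1r -um => -[h1 h2]; exists i, j, l', m.
have um' : u j m = ev (d + -1 * - x j) by rewrite mulrNN mul1r.
have near_j' m' : dot (u j m') (ev d) <= cos (- x j) by rewrite cosN.
have [||||m'] := next_point_close (c := - x i) (balu j) (unitu j)
  (or_intror erefl) um' near_j'; rewrite ?lerN2 ?cosN ?(ltW lt_ji) //; try lra.
rewrite mulrNN [1 * x i]mul1r -ul => -[h1 h2]; exists j, i, m', l.
by split; rewrite // eq_sym.
Qed.

(** * Choices of one point from each set, and the maximum *)

Lemma sum3 (V : nmodType) (F : 'I_3 -> V) i j k :
  i != j -> i != k -> j != k -> \sum_(x < 3) F x = F i + F j + F k.
Proof.
move=> ij ik jk.
rewrite (bigD1 i) //= (bigD1 j) 1?eq_sym //= (bigD1 k) /=; last first.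
  by rewrite ![k == _]eq_sym ik jk.
rewrite big1 ?addr0 ?addrA // => x /andP[/andP[xi xj] xk]; exfalso.
have uniq_s : uniq [:: i; j; k; x].
  by rewrite /= !inE !negb_or ij ik jk /= ![_ == x]eq_sym xi xj xk.
by have := max_card (mem [:: i; j; k; x]); rewrite (card_uniqP uniq_s) card_ord.
Qed.

Lemma other_index (i j : 'I_3) : exists k : 'I_3, i != k /\ j != k.
Proof.
have [k /andP[] |no] := pickP (fun k => (i != k) && (j != k)); first by exists k.
have /uniq_leq_size : {subset enum 'I_3 <= [:: i; j]}.
  move=> x _; rewrite !inE ![x == _]eq_sym; apply/negPn.
  by rewrite negb_or no.
by rewrite enum_uniq size_enum_ord => /(_ isT).
Qed.

(** Replaces finite functions by plain dependent ones; [0 <= b] accounts for the seed 0 of the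
    maximum. *)
Lemma max_sum_dist_le (R : realType) (k : 'I_3 -> nat)
    (u : forall i : 'I_3, 'I_(k i) -> 'cV[R]_2) (c : 'cV[R]_2) (b : R) : 0 <= b ->
  (max_sum_dist u c <= b) <->
  forall g : (forall i, 'I_(k i)), norm2 (\sum_(i < 3) u i (g i) - c) <= b.
Proof.
move=> b0; split.
  move=> le_b g; apply: le_trans le_b; rewrite /max_sum_dist.
  pose F (l : {dffun forall i, 'I_(k i)}) := norm2 (\sum_(i < 3) u i (l i) - c).
  have := le_bigmax 0 F [ffun i => g i]; rewrite {1}/F.
  by under eq_bigr do rewrite ffunE.
by move=> le_b; apply: bigmax_le => // l _; exact: le_b.
Qed.

Lemma triple_le (R : realType) (k : 'I_3 -> nat)
    (u : forall i : 'I_3, 'I_(k i) -> 'cV[R]_2) (c : 'cV[R]_2)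
    (i j h : 'I_3) l m n :
  (forall i, (0 < k i)%N) -> i != j -> i != h -> j != h ->
  norm2 (u i l + u j m + u h n - c) <= max_sum_dist u c.
Proof.
move=> k0 ij ih jh.
pose T i := 'I_(k i).
(* The default choice is overwritten at all three indices, as [i], [j], [h] exhaust ['I_3]. *)
pose g := eqtype.dfwith (eqtype.dfwith (eqtype.dfwith (T := T)
  (fun i => Ordinal (k0 i)) l) m) n.
have max0 : 0 <= max_sum_dist u c by exact: bigmax_ge_id.
have := (max_sum_dist_le u c max0).1 (lexx _) g.
rewrite (sum3 _ ij ih jh) /g dfwith_in.
rewrite dfwith_out 1?eq_sym // dfwith_out 1?eq_sym // dfwith_in.
by rewrite dfwith_out 1?eq_sym // dfwith_in.
Qed.

(** * The lower bound *)

(** For c = 0 any direction serves, so the lower bound needs no separate case. *)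
Lemma polar_norm (R : realType) (c : 'cV[R]_2) :
  exists d r, 0 <= r /\ c = r *: ev d.
Proof.
have [->|c0] := eqVneq c 0; first by exists 0, 0; rewrite scale0r.
pose r := Num.sqrt (dot c c).
have r0 : 0 < r.
  by rewrite sqrtr_gt0 lt_neqAle dot_ge0 andbT eq_sym; apply: contra_neq c0; apply: dot_eq0.
have rr : r ^+ 2 = dot c c by rewrite sqr_sqrtr // dot_ge0.
have unit_c : dot (r^-1 *: c) (r^-1 *: c) = 1.
  by rewrite dotZr dotC dotZr -rr; field; rewrite gt_eqF.
have [d _ dE] := polar 0 unit_c.
by exists (0 + d), r; rewrite -dE scalerA divff ?gt_eqF // scale1r ltW.
Qed.

Lemma far_triple (R : realType) (k : 'I_3 -> nat)
    (u : forall i : 'I_3, 'I_(k i) -> 'cV[R]_2) (c : 'cV[R]_2) :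
  (forall i, (0 < k i)%N) -> (forall i, balanced (u i)) ->
  (forall i l, dot (u i l) (u i l) = 1) ->
  exists i j h l m n, [/\ i != j, i != h, j != h &
    4 + dot c c <= dot (u i l + u j m + u h n - c) (u i l + u j m + u h n - c)].
Proof.
move=> k0 balu unitu; have [d [r [r0 cE]]] := polar_norm (- c).
have [i [j [l [m [ij close side]]]]] := close_pair d k0 balu unitu.
have [h [ih jh]] := other_index i j.
have [n n0] := balanced_ge0 (u i l + u j m - c) (balu h) (k0 h).
exists i, j, h, l, m, n; split=> //.
(* For the chosen x, y, z the square is 3 + |c|^2 + 2<x, y> + 2<x + y, -c> + 2<z, x + y - c>, with
   <x, y> >= 1/2 and the last two terms nonnegative. *)
have : 0 <= dot (u i l + u j m) (- c) by rewrite cE dotZr mulr_ge0.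
move: n0 (unitu i l) (unitu j m) (unitu h n) close.
rewrite !dotE (dotC (u j m) (u i l)) (dotC (u h n) (u i l)) (dotC (u h n) (u j m)).
rewrite (dotC c (u i l)) (dotC c (u j m)) (dotC c (u h n)).
lra.
Qed.

(** * Structure of the sets in the case of equality *)

(** By Cramer's rule the determinant [t] of x and y annihilates z, so t = 0; Lagrange's identity
    then gives <x, y>^2 = 1. *)
Lemma unit_perp (R : realType) (x y z : 'cV[R]_2) : z != 0 ->
  dot x x = 1 -> dot y y = 1 -> dot x z = 0 -> dot y z = 0 -> x = y \/ x = - y.
Proof.
move=> z0 x1 y1 xz yz.
pose t := x 0 0 * y 1 0 - x 1 0 * y 0 0.
have t0 : t = 0.
  apply/eqP; apply: contraNT z0 => t0; apply/eqP; apply: vec2P; rewrite mxE;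
    apply: (mulfI t0); rewrite mulr0 /t.
    transitivity (y 1 0 * dot x z - x 1 0 * dot y z); first by rewrite /dot; ring.
    by rewrite xz yz; ring.
  transitivity (x 0 0 * dot y z - y 0 0 * dot x z); first by rewrite /dot; ring.
  by rewrite xz yz; ring.
have : dot x y ^+ 2 = 1.
  transitivity (dot x x * dot y y - t ^+ 2); first by rewrite /dot /t; ring.
  by rewrite x1 y1 t0; ring.
move=> /eqP; rewrite sqrf_eq1 => /orP[]/eqP xy; [left|right];
  apply/eqP; rewrite -subr_eq0; apply/eqP/dot_eq0;
  rewrite !dotE (dotC y x) x1 y1 xy; ring.
Qed.

(** For unit vectors at angle pi/3, v - u is a unit vector orthogonal to u + v, so every point is v
    - u or its opposite; balance makes both occur. *)
Lemma range_pair (R : realType) n (U : 'I_n -> 'cV[R]_2) (u v : 'cV[R]_2) :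
  balanced U -> (0 < n)%N -> (forall l, dot (U l) (U l) = 1) ->
  dot u u = 1 -> dot v v = 1 -> dot u v = 1 / 2 ->
  (forall l, dot (U l) (u + v) = 0) -> range U = [set v - u; - (v - u)].
Proof.
move=> balU n0 unitU u1 v1 uv perp.
have w1 : dot (v - u) (v - u) = 1 by rewrite !dotE (dotC v u) u1 v1 uv; lra.
have wperp : dot (v - u) (u + v) = 0 by rewrite !dotE (dotC v u) u1 v1; ring.
have uv0 : u + v != 0.
  apply/eqP => uv0; have : dot u (u + v) = 0 by rewrite uv0 /dot !mxE; ring.
  by rewrite dotDr u1 uv; lra.
have pair l : U l = v - u \/ U l = - (v - u).
  exact: unit_perp uv0 (unitU l) w1 (perp l) wperp.
apply/seteqP; split => [_ [l _ <-]|]; first exact: pair.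
move=> _ [->|->].
  have [l] := balanced_ge0 (v - u) balU n0.
  have [<-|->] := pair l; first by exists l.
  by rewrite dotNl w1; lra.
have [l] := balanced_ge0 (- (v - u)) balU n0.
have [->|<-] := pair l; last by exists l.
by rewrite dotNr w1; lra.
Qed.

Lemma extremal_pairs (R : realType) (k : 'I_3 -> nat)
    (u : forall i : 'I_3, 'I_(k i) -> 'cV[R]_2) :
  (forall i, (0 < k i)%N) -> (forall i, balanced (u i)) ->
  (forall i l, dot (u i l) (u i l) = 1) -> max_sum_dist u 0 = 2 ->
  exists i j h x y, [/\ i != j, i != h & j != h] /\
    [/\ dot x x = 1, dot y y = 1, dot x y = 1 / 2 &
      [/\ range (u i) = [set x; - x], range (u j) = [set y; - y] &
          range (u h) = [set y - x; - (y - x)]]].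
Proof.
move=> k0 balu unitu max2.
have le4 i j h l m n : i != j -> i != h -> j != h ->
    dot (u i l + u j m + u h n) (u i l + u j m + u h n) <= 4.
  move=> ij ih jh; rewrite -norm2_le2 -max2 -[X in norm2 X]subr0.
  exact: triple_le.
(* Expanding the bound 4 gives 2<x, y> + 2<z, x + y> <= 1 for all z in the third set. Some z has <z,
   x + y> >= 0, which forces <x, y> = 1/2; then balance makes all <z, x + y> vanish. *)
have perp i j h l m : i != j -> i != h -> j != h -> 1 / 2 <= dot (u i l) (u j m) ->
    dot (u i l) (u j m) = 1 / 2 /\ forall n, dot (u h n) (u i l + u j m) = 0.
  move=> ij ih jh close.
  have le n : 2 * dot (u i l) (u j m) + 2 * dot (u h n) (u i l + u j m) <= 1.
    have := le4 i j h l m n ij ih jh.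
    rewrite !dotE (dotC (u j m) (u i l)) (dotC (u i l) (u h n)).
    by rewrite (dotC (u j m) (u h n)) !unitu; lra.
  split; last by apply: balu => n; have := le n; lra.
  have [n n0] := balanced_ge0 (u i l + u j m) (balu h) (k0 h).
  by have := le n; lra.
(* The direction 0 is arbitrary: only the closeness of the pair is kept. *)
have [i [j [l [m [ij close _]]]]] := close_pair 0 k0 balu unitu.
have [h [ih jh]] := other_index i j.
have [xy perp_h] := perp i j h l m ij ih jh close.
pose x := u i l; pose y := u j m.
have range_h : range (u h) = [set y - x; - (y - x)].
  exact: range_pair (balu h) (k0 h) (unitu h) (unitu i l) (unitu j m) xy perp_h.
have [n _ hn] : range (u h) (y - x) by rewrite range_h; left.
have [n' _ hn'] : range (u h) (- (y - x)) by rewrite range_h; right.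
have [x1 y1] : dot x x = 1 /\ dot y y = 1 by split; exact: unitu.
exists i, j, h, x, y; split=> //; split=> //; split=> //.
(* The pair y, y - x has difference -x, which yields the set of x; below, the pair x, x - y yields
   the set of y. *)
- have xy' : dot y (y - x) = 1 / 2.
    by rewrite dotDr dotNr unitu (dotC y) xy; lra.
  have [||||_ perp_i] := perp j h i m n; rewrite ?hn ?xy' // 1?eq_sym //.
  rewrite hn in perp_i; have w1 := unitu h n; rewrite hn in w1.
  rewrite (range_pair (balu i) (k0 i) (unitu i) (unitu j m) w1 xy' perp_i).
  by rewrite addrAC subrr sub0r opprK setUC.
- have xy' : dot x (- (y - x)) = 1 / 2.
    by rewrite dotNr dotDr dotNr unitu xy; lra.
  have [||||_ perp_j] := perp i h j l n'; rewrite ?hn' ?xy' // 1?eq_sym //.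
  rewrite hn' in perp_j; have w1 := unitu h n'; rewrite hn' in w1.
  rewrite (range_pair (balu j) (k0 j) (unitu j) (unitu i l) w1 xy' perp_j).
  by rewrite opprB addrAC subrr sub0r opprK setUC.
Qed.

(** * Rotations and the hexagonal configuration *)

Lemma rotation_mxE (R : realType) (t : R) (x : 'cV[R]_2) :
  rotation_mx t *m x = vec2 (cos t * x 0 0 - sin t * x 1 0)
                            (sin t * x 0 0 + cos t * x 1 0).
Proof.
have E0 i : rotation_mx t i 0 = vec2 (cos t) (sin t) i 0.
  transitivity (rotation_mx t i (@lshift 1 1 ord0)); last exact: row_mxEl.
  by congr (rotation_mx _ _ _); exact: val_inj.
have E1 i : rotation_mx t i 1 = vec2 (- sin t) (cos t) i 0.
  transitivity (rotation_mx t i (@rshift 1 1 ord0)); last exact: row_mxEr.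
  by congr (rotation_mx _ _ _); exact: val_inj.
apply: vec2P; rewrite mxE big_ord_recl big_ord1;
  rewrite (_ : lift ord0 ord0 = 1) ?E0 ?E1 ?mxE /= ?mulNr //; exact: val_inj.
Qed.

Lemma rotation_ev (R : realType) (t b : R) : rotation_mx t *m ev b = ev (b + t).
Proof.
rewrite rotation_mxE evE0 evE1; apply: vec2P; rewrite !mxE /= (cosD, sinD); ring.
Qed.

Lemma dot_rotation (R : realType) (t : R) (x y : 'cV[R]_2) :
  dot (rotation_mx t *m x) (rotation_mx t *m y) = dot x y.
Proof.
rewrite !rotation_mxE /dot !mxE /=.
transitivity ((cos t ^+ 2 + sin t ^+ 2) * dot x y); first by rewrite /dot; ring.
by rewrite cos2Dsin2 mul1r.
Qed.

(** With w = b + pi/3 this is ev(w - pi/3) + ev(w + pi/3) = 2 cos(pi/3) ev(w) = ev(w); the sines of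
    pi/3 cancel. *)
Lemma ev_hex (R : realType) (b : R) :
  ev (b + pi / 3) - ev b = ev (b + 2 * (pi / 3)) :> 'cV[R]_2.
Proof.
have c3 := cos_pi3 R.
have bE : b = b + pi / 3 - pi / 3 by rewrite addrK.
have b2 : b + 2 * (pi / 3) = b + pi / 3 + pi / 3 by ring.
apply: vec2P; rewrite b2 {2}bE; set w := b + pi / 3; rewrite !mxE /=.
  by rewrite cosB cosD c3; lra.
by rewrite sinB sinD c3; lra.
Qed.

(** The indicator of [x] has total sum at least 1, so it cannot vanish at all of [i], [j], [h]. *)
Lemma index_cases (i j h x : 'I_3) : i != j -> i != h -> j != h ->
  [\/ x = i, x = j | x = h].
Proof.
move=> ij ih jh; have := sum3 (fun y : 'I_3 => (x == y) : nat) ij ih jh.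
rewrite (bigD1 x) //= eqxx.
by case: eqVneq => [|_]; [constructor 1|case: eqVneq => [|_];
  [constructor 2|case: eqVneq => [|_]; [constructor 3|]]].
Qed.

Lemma hex_oriented (R : realType) (U : 'I_3 -> set 'cV[R]_2) (i j h : 'I_3) (a : R) :
  i != j -> i != h -> j != h ->
  U i = [set ev a; - ev a] ->
  U j = [set ev (a + pi / 3); - ev (a + pi / 3)] ->
  U h = [set ev (a + 2 * (pi / 3)); - ev (a + 2 * (pi / 3))] ->
  is_hex_configuration U.
Proof.
move=> ij ih jh Ui Uj Uh.
pose f (x : 'I_3) : 'I_3 := if x == i then 0 else if x == j then 1 else 2.
have [fi fj fh] : [/\ f i = 0, f j = 1 & f h = 2].
  rewrite /f !eqxx [j == i]eq_sym [h == i]eq_sym [h == j]eq_sym.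
  by rewrite (negPf ij) (negPf ih) (negPf jh).
have f_inj : injective f.
  by move=> x y; case: (index_cases x ij ih jh) => ->;
    case: (index_cases y ij ih jh) => ->; rewrite ?fi ?fj ?fh.
(* The rotation takes the angles a, a + pi/3, a + 2pi/3 to pi/3, 2pi/3, pi, while [f] numbers the
   sets in this order. *)
exists (pi / 3 - a), (perm f_inj) => x; rewrite permE.
have rot b m : b + (pi / 3 - a) = m%:R * pi / 3 ->
    (fun z => rotation_mx (pi / 3 - a) *m z) @` [set ev b; - ev b] = @hex_pair R m.
  by move=> bm; rewrite image_setU !image_set1 mulmxN rotation_ev bm.
by case: (index_cases x ij ih jh) => ->; rewrite ?fi ?fj ?fh ?Ui ?Uj ?Uh;
  [apply: (rot _ 1%N)|apply: (rot _ 2%N)|apply: (rot _ 3%N)]; lra.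
Qed.

(** The vector y lies at pi/3 from x on one side or the other. On the negative side the roles of x
    and y are exchanged, which only swaps the two points of the third set. *)
Lemma hex_of_pairs (R : realType) (U : 'I_3 -> set 'cV[R]_2) (i j h : 'I_3)
    (x y : 'cV[R]_2) :
  i != j -> i != h -> j != h -> dot x x = 1 -> dot y y = 1 -> dot x y = 1 / 2 ->
  U i = [set x; - x] -> U j = [set y; - y] -> U h = [set y - x; - (y - x)] ->
  is_hex_configuration U.
Proof.
move=> ij ih jh x1 y1 xy Ui Uj Uh; have pi0 := pi_gt0 R.
have [a _ xE] := polar 0 x1; rewrite add0r in xE.
have [t /andP[t1 t2] yE] := polar a y1.
have t_pi : `|t| = pi / 3.
  have : cos `|t| = cos (pi / 3).
    by rewrite cos_pi3 -xy xE yE dotC dot_ev cos_norm; congr cos; ring.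
  by apply: cos_inj; rewrite in_itv /= ?normr_ge0 ?ler_norml ?t1 ?t2 //;
    apply/andP; split; lra.
have [t0|t0] := leP 0 t.
  rewrite ger0_norm // in t_pi; rewrite t_pi in yE.
  by apply: (hex_oriented ij ih jh (a := a)); rewrite -?ev_hex -?xE -?yE.
rewrite ltr0_norm // in t_pi; have {}xE : x = ev (a + t + pi / 3).
  by rewrite xE; congr ev; lra.
apply: (@hex_oriented _ _ j i h (a + t)); rewrite -?ev_hex -?xE -?yE //.
  by rewrite eq_sym.
by rewrite Uh setUC !opprB.
Qed.

(** * The configuration attains 2, and conclusion *)

(** After rotation and reindexing by the inverse of [s], every sum is a signed sum of p, q and q - p
    with p, q at angle pi/3; each is 0 or twice a unit vector. *)
Lemma hex_dist_le (R : realType) (k : 'I_3 -> nat)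
    (u : forall i : 'I_3, 'I_(k i) -> 'cV[R]_2) :
  is_hex_configuration (fun i => range (u i)) -> max_sum_dist u 0 <= 2.
Proof.
move=> [t [s hex]]; apply/max_sum_dist_le => // g; rewrite subr0 norm2_le2.
rewrite -(dot_rotation t) mulmx_sumr (reindex_inj (@perm_inj _ s^-1%g)) /=.
pose f (m : 'I_3) := rotation_mx t *m u (s^-1%g m) (g (s^-1%g m)).
rewrite -[\sum_(m < 3) _]/(\sum_(m < 3) f m).
have fP (m : 'I_3) : @hex_pair R m.+1 (f m).
  by rewrite -{1}[m](permKV s) -hex; exists (u _ (g (s^-1%g m))) => //;
    exists (g (s^-1%g m)).
pose o2 : 'I_3 := lift ord0 (lift ord0 ord0); pose o1 : 'I_3 := lift ord0 ord0.
rewrite (@sum3 _ f ord0 o1 o2) //.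
pose p : 'cV[R]_2 := ev (pi / 3); pose q : 'cV[R]_2 := ev (pi / 3 + pi / 3).
have f0 : f ord0 = p \/ f ord0 = - p.
  by have := fP ord0; rewrite /hex_pair /= mul1r.
have f1 : f o1 = q \/ f o1 = - q.
  by have := fP o1; rewrite /hex_pair /= (_ : 2 * pi / 3 = pi / 3 + pi / 3) //; lra.
have f2 : f o2 = q - p \/ f o2 = - (q - p).
  rewrite ev_hex; have := fP o2.
  by rewrite /hex_pair /= (_ : 3 * pi / 3 = pi / 3 + 2 * (pi / 3)) //; lra.
have p1 : dot p p = 1 by rewrite dot_ev subrr cos0.
have q1 : dot q q = 1 by rewrite dot_ev subrr cos0.
have pq : dot p q = 1 / 2 by rewrite dotC dot_ev addrK cos_pi3.
case: f0 => ->; case: f1 => ->; case: f2 => ->;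
  rewrite !dotE (dotC q p) p1 q1 pq; lra.
Qed.

Theorem theorem1p3 (R : realType) (k : 'I_3 -> nat)
    (u : forall i : 'I_3, 'I_(k i) -> 'cV[R]_2)
    (lambda : forall i : 'I_3, 'I_(k i) -> R)
    (c : 'cV[R]_2)
    (hk : forall i : 'I_3, (2 <= k i <= 3)%N)
    (hu : forall (i : 'I_3) (l : 'I_(k i)), norm2 (u i l) = 1)
    (hlambda : forall (i : 'I_3) (l : 'I_(k i)), 0 < lambda i l)
    (hsum : forall i : 'I_3, \sum_(l < k i) lambda i l *: u i l = 0) :
  2 <= max_sum_dist u c /\
  (max_sum_dist u c = 2 <->
   c = 0 /\ is_hex_configuration (fun i => range (u i))).
Proof.
have k0 i : (0 < k i)%N by have /andP[/ltnW] := hk i.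
have balu i : balanced (u i) := balanced_sum (hlambda i) (hsum i).
have unitu i l : dot (u i l) (u i l) = 1 := norm2_eq1 (hu i l).
have [i [j [h [l [m [n [ij ih jh far]]]]]]] := far_triple c k0 balu unitu.
have le_max := triple_le u c l m n k0 ij ih jh.
have ge2 : 2 <= max_sum_dist u c.
  apply: le_trans le_max; rewrite norm2_ge2; apply: le_trans far.
  by rewrite lerDl dot_ge0.
split=> //; split=> [max2|[c0 hex]].
  have c0 : c = 0.
    apply: dot_eq0; apply: le_anti; rewrite dot_ge0 andbT.
    (* The far triple has squared norm at least 4 + |c|^2 and at most 4. *)
    by rewrite max2 norm2_le2 in le_max; lra.
  split=> //; rewrite c0 in max2.
  have [i' [j' [h' [x [y [[ij' ih' jh'] [x1 y1 xy [Ui Uj Uh]]]]]]]] :=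
    extremal_pairs k0 balu unitu max2.
  exact: hex_of_pairs ij' ih' jh' x1 y1 xy Ui Uj Uh.
by apply: le_anti; rewrite ge2 c0 hex_dist_le.
Qed.
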